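(* Let $\hat{\mathcal O}\subset\mathbb R^n$ be a bounded, connected Lipschitz domain, let $F\hat x=x_0+B\hat x$ with $x_0\in\mathbb R^n$ and $B\in\mathbb R^{n\times n}$ invertible, and let $\mathcal O=F(\hat{\mathcal O})$. Then for every $s\in(0,1)$ and every $v\in H^s(\mathcal O)$: (i) $\;|v|_{s,\mathcal O}\le |v|_{s,\mathcal O,\inf}$; (ii) $\;|v|_{s,\mathcal O,\inf}^2\le\Bigl(1+|\det B|^{-1}\,\|B\|^{n+2s}\,C_{\rm PF,SS}(s,\hat{\mathcal O})^2\Bigr)|v|_{s,\mathcal O}^2$, where $C_{\rm PF,SS}(s,\hat{\mathcal O})=|\hat{\mathcal O}|^{-1/2}\max\{1,2^{-1/2}D_{\hat{\mathcal O}}^{n/2+s}\}$.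
   Context: Functions are real valued. For a bounded connected Lipschitz domain $\mathcal O\subset\mathbb R^n$, $\|\cdot\|_{0,\mathcal O}$ is the $L^2(\mathcal O)$-norm, $|\mathcal O|$ the Lebesgue measure and $D_{\mathcal O}$ the diameter of $\mathcal O$. For $0<s<1$: the Sobolev-Slobodeckij semi-norm is $|v|_{s,\mathcal O}=\Bigl(\int_{\mathcal O}\int_{\mathcal O}\frac{|v(x)-v(y)|^2}{|x-y|^{n+2s}}\,dx\,dy\Bigr)^{1/2}$, the norm is $\|v\|_{s,\mathcal O}=\bigl(\|v\|_{0,\mathcal O}^2+|v|_{s,\mathcal O}^2\bigr)^{1/2}$, and $H^s(\mathcal O)$ is the space of $v\in L^2(\mathcal O)$ with $\|v\|_{s,\mathcal O}<\infty$. The quotient space semi-norm is $|v|_{s,\mathcal O,\inf}=\inf_{c\in\mathbb R}\|v+c\|_{s,\mathcal O}$. For matrices, $\|\cdot\|$ is the operator norm induced by the Euclidean norm. The number $C_{\rm PF,SS}(s,\mathcal O)=|\mathcal O|^{-1/2}\max\{1,2^{-1/2}D_{\mathcal O}^{n/2+s}\}$ is a constant for which $\|w\|_{0,\mathcal O}\le C_{\rm PF,SS}(s,\mathcal O)\bigl(|w|_{s,\mathcal O}+|\int_{\mathcal O}w|\bigr)$ holds for all $w\in H^s(\mathcal O)$. *)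

(* Defs.v *)
From HB Require Import structures.
From mathcomp Require Import all_boot all_order all_algebra.
From mathcomp Require Import all_classical all_reals all_analysis.
Set Implicit Arguments.
Unset Strict Implicit.
Unset Printing Implicit Defensive.
Import Order.TTheory GRing.Theory Num.Theory.
Import numFieldNormedType.Exports.
Local Open Scope classical_set_scope.
Local Open Scope ring_scope.

Section tuple_lebesgue.
Context {R : realType}.
Local Notation T := (measurableTypeR R).
Local Open Scope ereal_scope.

Definition pair_tuple n (p : T * n.-tuple T) : n.+1.-tuple T :=
  [the n.+1.-tuple T of p.1 :: p.2].

Lemma measurable_pair_tuple n : measurable_fun setT (@pair_tuple n).
Proof. exact: measurable_cons. Qed.

Section step.
Variables (n : nat) (m : {sigma_finite_measure set (n.-tuple T) -> \bar R}).

Definition tuple_step : set (n.+1.-tuple T) -> \bar R :=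
  pushforward (@lebesgue_measure R \x m) (@pair_tuple n).

Let mpair := @measurable_pair_tuple n.

Let step0 : tuple_step set0 = 0.
Proof. exact: measure0. Qed.

Let step_ge0 A : 0 <= tuple_step A.
Proof. exact: measure_ge0. Qed.

Let step_sigma_additive : semi_sigma_additive tuple_step.
Proof. exact: measure_semi_sigma_additive. Qed.

HB.instance Definition _ := isMeasure.Build _ _ _ tuple_step
  step0 step_ge0 step_sigma_additive.

Let step_sigma_finite : sigma_finite setT tuple_step.
Proof.
have /sigma_finiteP[F [TF ndF Foo]] := sigma_finiteT (@lebesgue_measure R).
have /sigma_finiteP[G [TG ndG Goo]] := sigma_finiteT m.
pose g (t : n.+1.-tuple T) : T * n.-tuple T := (thead t, [tuple of behead t]).
have mg : measurable_fun setT g.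
  apply: measurable_fun_pair; last exact: measurable_behead.
  exact: measurable_tnth.
have gK : cancel (@pair_tuple n) g.
  by move=> [x t]; rewrite /g /pair_tuple /= theadE; congr pair; apply: val_inj.
exists (fun k => g @^-1` (F k `*` G k)) => [|k].
  rewrite -preimage_bigcup; apply/seteqP; split => // t _ /=.
  have [a _ Fa] : (\bigcup_k F k) (g t).1 by rewrite -TF.
  have [b _ Gb] : (\bigcup_k G k) (g t).2 by rewrite -TG.
  exists (maxn a b) => //; split.
  - by move: Fa; exact/subsetPset/ndF/leq_maxl.
  - by move: Gb; exact/subsetPset/ndG/leq_maxr.
have [mF Fk] := Foo k; have [mG Gk] := Goo k; split.
  by rewrite -[X in measurable X]setTI; apply: mg => //; exact: measurableX.
rewrite /tuple_step /pushforward (_ : _ @^-1` _ = F k `*` G k); last first.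
  by rewrite -comp_preimage (_ : g \o _ = id) //; exact/funext.
by rewrite product_measure1E// lte_mul_pinfty// ge0_fin_numE.
Qed.

HB.instance Definition _ := Measure_isSigmaFinite.Build _ _ _ tuple_step
  step_sigma_finite.

End step.

Fixpoint tuple_lebesgue n : {sigma_finite_measure set (n.-tuple T) -> \bar R} :=
  if n is n'.+1 then tuple_step (tuple_lebesgue n')
  else dirac [tuple].

Lemma tuple_lebesgue_box n (a b : 'I_n -> R) : (forall i, a i <= b i)%R ->
  measurable [set t : n.-tuple T | forall i, (a i < tnth t i <= b i)%R] /\
  tuple_lebesgue n [set t : n.-tuple T | forall i, (a i < tnth t i <= b i)%R] =
    (\prod_i (b i - a i))%:E.
Proof.
elim: n a b => [|n IHn] a b ab.
  rewrite (_ : [set _ | _] = setT); last by apply/seteqP; split=> t // _ [].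
  by rewrite big_ord0 /= diracT; split.
have [mB EB] := IHn (a \o lift ord0) (b \o lift ord0) (fun i => ab _).
set B := [set t | _] in mB EB; set A := [set t | _].
have AE : @pair_tuple n @^-1` A = `]a ord0, b ord0] `*` B.
  apply/seteqP; split => -[x t]; rewrite /A /B /= => H.
    split; first by have := H ord0; rewrite in_itv.
    by move=> i; have := H (lift ord0 i); rewrite tnthS.
  move=> i; case: (unliftP ord0 i) => [j ->|->].
    by rewrite tnthS; exact: H.2.
  by have := H.1; rewrite in_itv.
split.
  rewrite (_ : A = \bigcap_(i in [set: 'I_n.+1])
      ((@tnth n.+1 T)^~ i @^-1` `]a i, b i])); last first.
    apply/seteqP; split => t At i; first by move=> _; rewrite /= in_itv; exact: At.
    by have := At i I; rewrite /= in_itv.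
  apply: fin_bigcap_measurable => // i _.
  rewrite -[X in measurable X]setTI.
  by apply: (@measurable_tnth _ T) => //; exact: (measurable_itv `]a i, b i]).
rewrite /= /tuple_step /pushforward AE.
rewrite [LHS]product_measure1E//.
rewrite EB [X in X * _](_ : _ = (b ord0 - a ord0)%:E); last first.
  rewrite [LHS]lebesgue_measure_itv /= lte_fin.
  have [//|ba] := ltP (a ord0) (b ord0).
  by rewrite (_ : b ord0 = a ord0) ?subrr //; apply/le_anti; rewrite ba ab.
by rewrite -EFinM big_ord_recl.
Qed.

End tuple_lebesgue.

Section col_lebesgue.
Context {R : realType}.
Local Notation T := (measurableTypeR R).
Local Open Scope ereal_scope.

Definition col_tuple n (x : 'cV[R]_n) : n.-tuple T := [tuple x i ord0 | i < n].
Definition tuple_col n (t : n.-tuple T) : 'cV[R]_n := \col_i tnth t i.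

Lemma tuple_colK n : cancel (@tuple_col n) (@col_tuple n).
Proof. by move=> t; apply: eq_from_tnth => i; rewrite tnth_mktuple mxE. Qed.

Lemma col_tupleK n : cancel (@col_tuple n) (@tuple_col n).
Proof. by move=> x; apply/colP => i; rewrite mxE tnth_mktuple. Qed.

(* 'cV[R]_n with the sigma-algebra generated by the coordinates, which is the
   Borel sigma-algebra. *)
Definition borel_col (n : nat) : Type := 'cV[R]_n.

Definition borel_col_display : measure_display.
Proof. exact: default_measure_display. Qed.

Section borel_col_measurable.
Variable n : nat.
Let U : measurableType _ := g_sigma_algebra_preimageType (@col_tuple n).

HB.instance Definition _ := Pointed.copy (borel_col n) 'cV[R]_n.
HB.instance Definition _ := @isMeasurable.Build borel_col_display
  (borel_col n) (@measurable _ U) (@measurable0 _ U) (@measurableC _ U)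
  (@bigcupT_measurable _ U).

End borel_col_measurable.

Lemma measurable_tuple_col n :
  measurable_fun setT (@tuple_col n : n.-tuple T -> borel_col n).
Proof.
move=> _ _ [A mA <-]; rewrite !setTI -comp_preimage.
by rewrite (_ : _ \o _ = id) //; apply/funext/tuple_colK.
Qed.

Definition borel_lebesgue n : set (borel_col n) -> \bar R :=
  pushforward (tuple_lebesgue n) (@tuple_col n : n.-tuple T -> borel_col n).

Section instance.
Variable n : nat.
Let mtuple_col := @measurable_tuple_col n.

Let borel_lebesgue0 : @borel_lebesgue n set0 = 0.
Proof. exact: measure0. Qed.

Let borel_lebesgue_ge0 A : 0 <= @borel_lebesgue n A.
Proof. exact: measure_ge0. Qed.

Let borel_lebesgue_sigma_additive : semi_sigma_additive (@borel_lebesgue n).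
Proof. exact: measure_semi_sigma_additive. Qed.

HB.instance Definition _ := isMeasure.Build _ _ _ (@borel_lebesgue n)
  borel_lebesgue0 borel_lebesgue_ge0 borel_lebesgue_sigma_additive.

End instance.

(* Carathéodory completion: the measurable sets of [lebesgue_space] are the
   Lebesgue-measurable sets of R^n, not only the Borel sets. *)
Definition lebesgue_space n : measurableType _ :=
  caratheodory_type (@borel_lebesgue n)^*%mu.

Definition lebesgue_col n : set (lebesgue_space n) -> \bar R :=
  @completed_measure_extension _ _ _ (@borel_lebesgue n).

HB.instance Definition _ n := Measure.on (@lebesgue_col n).

Lemma lebesgue_col_box n (a b : 'cV[R]_n) :
  (forall i, a i ord0 <= b i ord0)%R ->
  lebesgue_col [set x | forall i, (a i ord0 < x i ord0 <= b i ord0)%R] =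
    (\prod_i (b i ord0 - a i ord0))%:E.
Proof.
move=> /(@tuple_lebesgue_box R n (a ^~ ord0) (b ^~ ord0))[mB <-].
set A := [set x | _]; set B := [set t | _] in mB *.
have BE : @tuple_col n @^-1` A = B.
  by apply/seteqP; split => t H i; have := H i; rewrite mxE.
have mA : measurable (A : set (borel_col n)).
  exists B => //; rewrite setTI -BE -comp_preimage.
  by rewrite (_ : _ \o _ = id) //; apply/funext/col_tupleK.
rewrite /lebesgue_col /completed_measure_extension measurable_mu_extE //.
by rewrite /borel_lebesgue /= -BE.
Qed.

End col_lebesgue.
Arguments lebesgue_space R n : clear implicits.
Arguments lebesgue_col {R} n.

Section sobolev_slobodeckij.
Context {R : realType} {n : nat}.
Implicit Types (x y : 'cV[R]_n) (D : set 'cV[R]_n) (v : 'cV[R]_n -> R) (s : R).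

(* The norm provided by the library on matrices is the sup-norm; it is used here
   only for notions that do not depend on the choice of a norm (open, bounded,
   Lipschitz). *)
Definition enorm m (x : 'cV[R]_m) : R := Num.sqrt (\sum_i x i ord0 ^+ 2).

Definition opnorm (B : 'M[R]_n) : R :=
  sup [set enorm (B *m x) | x in [set x | enorm x <= 1]].

Definition diam D : R := sup [set enorm (x - y) | x in D & y in D].

Definition volume D : R := fine (lebesgue_col n D).

(* Near each boundary point p, after the orthogonal change of coordinates Q, the
   set D lies strictly above the graph of a Lipschitz function g of the n - 1
   coordinates other than the k-th one. *)
Definition lipschitz_boundary D :=
  forall p, (closure D `\` D^°) p ->
  exists r (Q : 'M[R]_n) (k : 'I_n) (g : 'cV[R]_n.-1 -> R),
    [/\ 0 < r, Q^T *m Q = 1%:M, lipschitz (g : 'cV[R]_n.-1 -> R^o) &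
      forall x, enorm (x - p) < r ->
        D x <-> g (row' k (Q *m x)) < (Q *m x) k ord0].

Definition lipschitz_domain D :=
  [/\ D !=set0, open D, bounded_set D, connected D & lipschitz_boundary D].

Local Open Scope ereal_scope.

(* Norms and semi-norms take values in \bar R, so that they are meaningful
   also for functions outside H^s. *)
Definition L2norm D v : \bar R :=
  (\int[lebesgue_col n]_(x in D) (v x ^+ 2)%:E) `^ 2^-1.

(* On the diagonal x = y the integrand is 0 / 0 = 0. *)
Definition slobodeckij s D v : \bar R :=
  (\int[lebesgue_col n]_(y in D) \int[lebesgue_col n]_(x in D)
     (`|v x - v y| ^+ 2 / enorm (x - y) `^ (n%:R + 2 * s))%:E) `^ 2^-1.

Definition sobolev_norm s D v : \bar R :=
  (L2norm D v ^+ 2 + slobodeckij s D v ^+ 2) `^ 2^-1.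

Definition sobolev s D : set ('cV[R]_n -> R) :=
  [set v : 'cV[R]_n -> R |
    [/\ @measurable_fun _ _ (lebesgue_space R n) R D v, L2norm D v < +oo &
        sobolev_norm s D v < +oo]].

Definition quotient_seminorm s D v : \bar R :=
  ereal_inf [set sobolev_norm s D (fun x => v x + c)%R | c in setT].

Definition CPFSS s D : R :=
  (volume D `^ (- 2^-1) *
   Num.max 1 (2 `^ (- 2^-1) * diam D `^ (n%:R / 2 + s)))%R.

End sobolev_slobodeckij.

(* Main.v *)
(* Part (i) holds because |v + c|_s = |v|_s for every constant c.  For (ii), take
   c = - m with m the mean of v over D.  Expanding the square gives
   int_D int_D |v x - v y|^2 = 2 |D| int_D |v - m|^2, and on D x D the numerator
   |v x - v y|^2 is at most (||B|| diam Dhat)^(n + 2 s) times the Slobodeckij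
   quotient, while |D| = |det B| |Dhat|; this is the Poincare inequality with the
   required constant, directly on D.  The formula for |D| is proved by induction
   on n: a matrix with nonzero upper left entry is the product of a map changing
   only the last n coordinates and a map changing only the first one, and each
   of these scales Lebesgue measure by Fubini; a row operation reduces to a
   nonzero upper left entry. *)

Require Import Defs.
From mathcomp Require Import all_boot all_order all_algebra.
From mathcomp Require Import all_classical all_reals all_analysis.
From mathcomp Require Import measurable_realfun ring lra.
Set Implicit Arguments.
Unset Strict Implicit.
Unset Printing Implicit Defensive.
Import Order.TTheory GRing.Theory Num.Theory.
Import numFieldNormedType.Exports.
Local Open Scope classical_set_scope.
Local Open Scope ring_scope.

(** * Affine maps of the real line *)

Section affine_invariance.
Context {R : realType}.
Local Notation T := (measurableTypeR R).

(** The pushforward under the map, multiplied by [|a|], gives half-open intervals their length, so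
    it is Lebesgue measure by uniqueness. *)
Lemma lebesgue_measure_affine (a z : R) (A : set R) : a != 0 ->
  measurable (A : set T) ->
  lebesgue_measure ((fun x => a * x + z) @^-1` A) =
    (`|a|^-1%:E * lebesgue_measure A)%E.
Proof.
move=> a0 mA.
have mf : measurable_fun setT (fun x : T => a * x + z : T).
  by apply: measurable_funD => //; exact: measurable_funM.
have na0 : 0 <= `|a| by [].
pose mu := mscale (NngNum na0)
  (pushforward (@lebesgue_measure R) (fun x : T => a * x + z : T)).
suff -> : lebesgue_measure A = mu mf A.
  by rewrite /mu /mscale /= muleA -EFinM mulVf ?normr_eq0// mul1e.
apply: (lebesgue_measure_unique _ mA) => _ [[l r] /= _ <-].
rewrite /mu /mscale /= /pushforward.
have [a_gt0|a_lt0|/eqP] := ltgtP 0 a; last by rewrite eq_sym (negPf a0).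
- rewrite (_ : _ @^-1` _ = `]((l - z) / a), ((r - z) / a)]%classic); last first.
    apply/seteqP; split => x /=; rewrite !in_itv/= ltr_pdivrMr// ler_pdivlMr//;
      by rewrite ltrBlDr lerBrDr mulrC.
  rewrite !lebesgue_measure_itv /= !lte_fin ltr_pM2r ?invr_gt0// ltrD2r.
  case: ifPn => _; last by rewrite mule0.
  rewrite -EFinD -EFinM gtr0_norm//; congr (_%:E); field; exact: lt0r_neq0.
(* A negative slope swaps the endpoints: the interval becomes closed on the left and open on the
   right, with the same length formula. *)
- rewrite (_ : _ @^-1` _ = `[((r - z) / a), ((l - z) / a)[%classic); last first.
    apply/seteqP; split => x /=; rewrite !in_itv/= ltr_ndivlMr// ler_ndivrMr//;
      by rewrite ltrBlDr lerBrDr mulrC andbC.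
  rewrite !lebesgue_measure_itv /= !lte_fin ltr_nM2r ?invr_lt0// ltrD2r.
  case: ifPn => _; last by rewrite mule0.
  rewrite -EFinD -EFinM ltr0_norm//; congr (_%:E); field; exact: ltr0_neq0.
Qed.

End affine_invariance.

(** * Maps of a product that change one coordinate only *)

Section product_preimage.
Context {R : realType} {d1 d2 : measure_display}.
Context {T1 : measurableType d1} {T2 : measurableType d2}.
Variables (m1 : {sigma_finite_measure set T1 -> \bar R}).
Variables (m2 : {sigma_finite_measure set T2 -> \bar R}).
Local Open Scope ereal_scope.

Lemma product_measure12 (A : set (T1 * T2)) : measurable A ->
  (m1 \x m2) A = (m1 \x^ m2) A.
Proof.
by move=> mA; apply: product_measure_unique mA => C E mC mE; exact: product_measure2E.
Qed.

(** The section of the preimage at [x] is the preimage of the section of [A] under [g (x, _)], so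
    its measure scales by [k]; integrating over [x] keeps the factor. *)
Lemma product_measure_preimage_snd (g : T1 * T2 -> T2) (k : R)
    (A : set (T1 * T2)) : (0 <= k)%R -> measurable_fun setT g ->
  (forall x C, measurable C -> m2 ((fun y => g (x, y)) @^-1` C) = k%:E * m2 C) ->
  measurable A ->
  (m1 \x m2) ((fun p => (p.1, g p)) @^-1` A) = k%:E * (m1 \x m2) A.
Proof.
move=> k0 mg gE mA; rewrite /product_measure1 -ge0_integralZl//;
  last exact: measurable_fun_xsection.
apply: eq_integral => x _ /=.
by rewrite -(gE x); [congr (m2 _); apply/seteqP; split => y; rewrite /xsection /= !inE
  | exact: measurable_xsection].
Qed.

(** Same argument with sections at fixed [y], after exchanging the order of integration by
    [product_measure12]. *)
Lemma product_measure_preimage_fst (g : T1 * T2 -> T1) (k : R)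
    (A : set (T1 * T2)) : (0 <= k)%R -> measurable_fun setT g ->
  (forall y C, measurable C -> m1 ((fun x => g (x, y)) @^-1` C) = k%:E * m1 C) ->
  measurable A ->
  (m1 \x m2) ((fun p => (g p, p.2)) @^-1` A) = k%:E * (m1 \x m2) A.
Proof.
move=> k0 mg gE mA; rewrite !product_measure12//; last first.
  rewrite -[X in measurable X]setTI.
  by apply: (measurable_fun_pair mg measurable_snd).
rewrite /product_measure2 -ge0_integralZl//; last exact: measurable_fun_ysection.
apply: eq_integral => y _ /=.
by rewrite -(gE y); [congr (m1 _); apply/seteqP; split => x; rewrite /ysection /= !inE
  | exact: measurable_ysection].
Qed.

End product_preimage.

(** * Affine maps and the recursively defined measure on tuples *)

Section tuple_affine.
Context {R : realType}.
Local Notation T := (measurableTypeR R).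

Definition tuple_affine n (z : 'cV[R]_n) (M : 'M[R]_n) (t : n.-tuple T) :
  n.-tuple T :=
  col_tuple (z + M *m tuple_col t).

Lemma tuple_col_pair n (p : T * n.-tuple T) :
  tuple_col (pair_tuple p) =
    col_mx ((p.1)%:M : 'M[R]_1) (tuple_col p.2) :> 'cV[R]_(1 + n).
Proof.
case: p => x t /=; apply/colP => i; rewrite !mxE; case: splitP => j ij.
  rewrite !mxE ord1 eqxx mulr1n (_ : i = ord0)//.
  by apply: val_inj; rewrite [LHS]ij ord1.
by rewrite !mxE (_ : i = lift ord0 j) ?tnthS//; exact: val_inj.
Qed.

(** The translation may vary with [u], since the shear in the pivot case shifts the last coordinates
    by a multiple of the first. *)
Lemma measurable_tuple_affine d (U : measurableType d) n (M : 'M[R]_n)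
    (z : U -> 'cV[R]_n) (t : U -> n.-tuple T) :
  (forall i, measurable_fun setT (fun u => z u i ord0 : T)) ->
  measurable_fun setT t ->
  measurable_fun setT (fun u => tuple_affine (z u) M (t u)).
Proof.
move=> mz mt; apply/measurable_fun_tnthP => i.
rewrite (_ : _ \o _ = fun u => z u i ord0 + \sum_j M i j * tnth (t u) j); last first.
  apply/funext => u /=; rewrite /tuple_affine tnth_mktuple !mxE; congr (_ + _).
  by apply: eq_bigr => j _; rewrite mxE.
apply: measurable_funD; first exact: mz.
apply: measurable_sum => j; apply: measurable_funM => //.
exact: (measurableT_comp (@measurable_tnth _ T n j) mt).
Qed.

(** Block elimination: the right factor of [M] changes only the first coordinate, with slope [a].
    The left factor fixes the first coordinate and acts on the others affinely with matrix [N], to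
    which the induction hypothesis applies. The scalings multiply because [\det M = a * \det N]. *)
Lemma tuple_lebesgue_affine_pivot n (z : 'cV[R]_(1 + n)) (M : 'M[R]_(1 + n))
    (A : set ((1 + n).-tuple T)) :
  (forall (z : 'cV[R]_n) (M : 'M[R]_n) A, M \in unitmx -> measurable A ->
    tuple_lebesgue n (tuple_affine z M @^-1` A) =
      (`|\det M|^-1%:E * tuple_lebesgue n A)%E) ->
  M \in unitmx -> M ord0 ord0 != 0 -> measurable A ->
  tuple_lebesgue (1 + n) (tuple_affine z M @^-1` A) =
    (`|\det M|^-1%:E * tuple_lebesgue (1 + n) A)%E.
Proof.
move=> IH uM a0 mA.
set a := M ord0 ord0 in a0 *.
pose r : 'rV_n := ursubmx M; pose c : 'cV_n := a^-1 *: dlsubmx M.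
(* The Schur complement of the pivot. *)
pose N : 'M[R]_n := drsubmx M - c *m r.
have ulM : ulsubmx M = a%:M :> 'M[R]_1.
  rewrite [LHS]mx11_scalar !mxE; congr (M _ _)%:M; exact: val_inj.
have ME : M = block_mx 1%:M 0 c N *m block_mx a%:M r 0 1%:M.
  rewrite mulmx_block !mul1mx !mul0mx !mulmx0 !addr0 mulmx1 -[LHS]submxK ulM -/r.
  congr block_mx; last by rewrite /N addrC subrK.
  by rewrite mul_mx_scalar /c scalerA divff// scale1r.
have detM : \det M = a * \det N.
  by rewrite ME det_mulmx det_lblock det_ublock !det1 det_scalar1 mul1r mulr1 mulrC.
have uN : N \in unitmx.
  by move: uM; rewrite !unitmxE detM unitrM => /andP[].
(* The shift [z0] is applied with the first factor, and the second then adds [z0 *: c] to the other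
   coordinates; [z1] compensates for this. *)
pose z0 := z ord0 ord0; pose z1 : 'cV_n := dsubmx z - z0 *: c.
have uz : usubmx z = z0%:M :> 'M[R]_1.
  rewrite [LHS]mx11_scalar !mxE; congr (z _ _)%:M; exact: val_inj.
pose u (p : T * n.-tuple T) : T := a * p.1 + ((r *m tuple_col p.2) ord0 ord0 + z0).
pose l (p : T * n.-tuple T) : n.-tuple T := tuple_affine (z1 + p.1 *: c) N p.2.
have factor p : tuple_affine z M (@pair_tuple _ n p) =
    @pair_tuple _ n (u p, l (u p, p.2)).
  rewrite /tuple_affine tuple_col_pair -[RHS]tuple_colK; congr col_tuple.
  rewrite tuple_col_pair /= /l /tuple_affine col_tupleK ME -mulmxA !mul_block_col.
  rewrite !mul1mx !mul0mx !add0r addr0 -[z]vsubmxK add_col_mx uz.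
  have uE : (u p)%:M = z0%:M + (a%:M *m (p.1)%:M + r *m tuple_col p.2) :> 'M[R]_1.
    rewrite -scalar_mxM [r *m _]mx11_scalar -!raddfD /=; congr (_%:M).
    by rewrite /u addrA addrC.
  congr col_mx; first by rewrite uE.
  rewrite addrA; congr (_ + _).
  by rewrite -[u p *: c]mul_mx_scalar uE !mulmxDr [c *m z0%:M]mul_mx_scalar
    /z1 [RHS]addrA subrK.
have mu_ : measurable_fun setT u.
  rewrite /u; apply: measurable_funD; first by apply: measurable_funM.
  apply: measurable_funD => //.
  have -> : (fun p : T * n.-tuple T => (r *m tuple_col p.2) ord0 ord0) =
      fun p => \sum_j r ord0 j * tnth p.2 j.
    by apply/funext => q; rewrite mxE; apply: eq_bigr => j _;
      rewrite [tuple_col _ _ _]mxE.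
  apply: measurable_sum => j; apply: measurable_funM => //.
  exact: (measurableT_comp (@measurable_tnth _ T n j) measurable_snd).
have ml : measurable_fun setT l.
  apply: measurable_tuple_affine => // i.
  have -> : (fun p : T * n.-tuple T => (z1 + p.1 *: c) i ord0 : T) =
      fun p => z1 i ord0 + p.1 * c i ord0.
    by apply/funext => q; rewrite !mxE.
  by apply: measurable_funD => //; apply: measurable_funM.
have mA' : measurable (@pair_tuple _ n @^-1` A).
  by rewrite -[X in measurable X]setTI; exact: measurable_pair_tuple.
rewrite /= /tuple_step /pushforward.
rewrite (_ : _ @^-1` (_ @^-1` A) = (fun p => (u p, p.2)) @^-1`
    ((fun p => (p.1, l p)) @^-1` (@pair_tuple _ n @^-1` A))); last first.
  by apply/seteqP; split => p /=; rewrite factor.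
have ia k : 0 <= `|k|^-1 :> R by rewrite invr_ge0.
rewrite (@product_measure_preimage_fst _ _ _ _ _ _ _ u `|a|^-1)//; last 2 first.
- move=> y C mC.
  by rewrite -(lebesgue_measure_affine ((r *m tuple_col y) ord0 ord0 + z0)).
- rewrite -[X in measurable X]setTI.
  by apply: (measurable_fun_pair (@measurable_fst _ _ _ _) ml).
rewrite (@product_measure_preimage_snd _ _ _ _ _ _ _ l `|\det N|^-1)//; last first.
  by move=> x C mC; rewrite -(IH (z1 + x *: c)).
by rewrite muleA -EFinM detM normrM invfM.
Qed.

Lemma tuple_affine_comp n (z z' : 'cV[R]_n) (M M' : 'M[R]_n) (t : n.-tuple T) :
  tuple_affine z M (tuple_affine z' M' t) =
    tuple_affine (z + M *m z') (M *m M') t.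
Proof. by rewrite /tuple_affine col_tupleK mulmxDr addrA mulmxA. Qed.

(** Induction on [n]. When the pivot vanishes, [M] is written as [E (-1)] times [E 1 *m M]; both
    factors have a nonzero pivot and [E (-1)] has determinant 1. *)
Lemma tuple_lebesgue_affine n (z : 'cV[R]_n) (M : 'M[R]_n) (A : set (n.-tuple T)) :
  M \in unitmx -> measurable A ->
  tuple_lebesgue n (tuple_affine z M @^-1` A) =
    (`|\det M|^-1%:E * tuple_lebesgue n A)%E.
Proof.
elim: n => [|n IH] in z M A * => uM mA.
  rewrite det_mx00 normr1 invr1 mul1e (_ : tuple_affine z M = id)//.
  by apply/funext => t; rewrite [LHS]tuple0 [RHS]tuple0.
have pivot (z' : 'cV_n.+1) (M' : 'M[R]_n.+1) A' : M' \in unitmx ->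
    M' ord0 ord0 != 0 -> measurable A' ->
    tuple_lebesgue n.+1 (tuple_affine z' M' @^-1` A') =
      (`|\det M'|^-1%:E * tuple_lebesgue n.+1 A')%E.
  exact: (@tuple_lebesgue_affine_pivot n).
have [a0|] := eqVneq (M ord0 ord0) 0; last by move=> ?; exact: pivot.
have [i Mi0] : exists i, M i ord0 != 0.
  apply/existsP; apply: contraLR uM; rewrite negb_exists => /forallP M0.
  rewrite unitmxE unitfE negbK (expand_det_col _ ord0) big1// => i _.
  by have := M0 i; rewrite negbK => /eqP ->; rewrite mul0r.
have i0 : i != ord0 by apply: contraNneq Mi0 => ->; rewrite a0.
(* Adding row [i] to row [0] makes the pivot nonzero. *)
pose E s : 'M[R]_n.+1 := 1%:M + s *: delta_mx ord0 i.
have EE s s' : E s *m E s' = E (s + s').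
  rewrite /E mulmxDr mulmx1 mulmxDl mul1mx -scalemxAl -scalemxAr mul_delta_mx_0//.
  by rewrite !scaler0 addr0 scalerDl addrA addrAC.
have E00 s : E s ord0 ord0 = 1.
  by rewrite !mxE eqxx /= eq_sym (negPf i0) mulr0 addr0.
have detE s : \det (E s) = 1.
  (* [E s] is upper triangular, as its extra entry lies in row 0; its transpose is lower triangular,
     as [det_trig] requires. *)
  rewrite -det_tr det_trig; last first.
    apply/is_trig_mxP => j k jk; rewrite !mxE.
    rewrite (_ : (k == j) = false); last by apply/eqP => kj; rewrite kj ltnn in jk.
    by case: eqP => [k0|]; rewrite ?andbF ?mulr0 ?addr0//; move: jk; rewrite k0 ltn0.
  rewrite big1// => j _; rewrite !mxE eqxx; case: eqP => [->|];
    last by rewrite mulr0 addr0.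
  by rewrite eq_sym (negPf i0) mulr0 addr0.
have uE s : E s \in unitmx by rewrite unitmxE detE unitr1.
have ME : M = E (-1) *m (E 1 *m M).
  by rewrite mulmxA EE addNr /E scale0r addr0 mul1mx.
have -> : tuple_affine z M = tuple_affine z (E (-1)) \o tuple_affine 0 (E 1 *m M).
  by apply/funext => t /=; rewrite tuple_affine_comp mulmx0 addr0 -ME.
have mEA : measurable (tuple_affine z (E (-1)) @^-1` A).
  rewrite -[X in measurable X]setTI.
  by apply: (@measurable_tuple_affine _ _ _ _ (fun=> z) id).
rewrite comp_preimage pivot//; last 2 first.
- by rewrite unitmx_mul uE.
- rewrite /E mulmxDl mul1mx scale1r mxE a0 add0r mxE (bigD1 i)//= big1 => [|j ji].
    by rewrite mxE !eqxx mul1r addr0.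
  by rewrite mxE (negPf ji) andbF mul0r.
rewrite pivot ?E00 ?oner_neq0// detE normr1 invr1 mul1e.
by rewrite det_mulmx detE mul1r.
Qed.

End tuple_affine.

(** * Lebesgue measure on columns: affine images, open sets, bounded sets *)

Section lebesgue_col_affine.
Context {R : realType} {n : nat}.
Local Notation T := (measurableTypeR R).
Implicit Types A D : set 'cV[R]_n.

(** On these sets [lebesgue_col] reduces to [tuple_lebesgue]; they include open sets and their
    images under invertible affine maps. *)
Definition borel A := measurable (A : set (borel_col n)).

Lemma borelP A : borel A <-> measurable (@tuple_col R n @^-1` A).
Proof.
split=> [mA|mA].
  by rewrite -[X in measurable X]setTI; exact: measurable_tuple_col.
exists (@tuple_col R n @^-1` A) => //; rewrite setTI -comp_preimage.
by rewrite (_ : _ \o _ = id) //; apply/funext/col_tupleK.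
Qed.

Lemma borel_lebesgue_measurable A :
  borel A -> measurable (A : set (lebesgue_space R n)).
Proof. exact: caratheodory_measurable_mu_ext. Qed.

Lemma lebesgue_col_borel A :
  borel A -> lebesgue_col n A = tuple_lebesgue n (@tuple_col R n @^-1` A).
Proof.
by move=> mA; rewrite /lebesgue_col /completed_measure_extension measurable_mu_extE.
Qed.

(** Rewrites the image as a preimage under the inverse map, the form treated by
    [tuple_lebesgue_affine]. *)
Lemma affine_image_preimage (z : 'cV[R]_n) (B : 'M[R]_n) A : B \in unitmx ->
  @tuple_col R n @^-1` [set z + B *m x | x in A] =
  tuple_affine (- (invmx B *m z)) (invmx B) @^-1` (@tuple_col R n @^-1` A).
Proof.
move=> uB; apply/seteqP; split => t /=; rewrite /tuple_affine col_tupleK.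
  by move=> [x Ax <-]; rewrite mulmxDr addKr mulKmx.
move=> At; exists (- (invmx B *m z) + invmx B *m tuple_col t) => //.
by rewrite mulmxDr mulmxN !mulKVmx// addrA subrr add0r.
Qed.

Lemma borel_affine_image (z : 'cV[R]_n) (B : 'M[R]_n) A : B \in unitmx ->
  borel A -> borel [set z + B *m x | x in A].
Proof.
move=> uB /borelP mA; apply/borelP; rewrite affine_image_preimage//.
rewrite -[X in measurable X]setTI.
by apply: (@measurable_tuple_affine _ _ _ _ _ (fun=> _) id).
Qed.

Lemma lebesgue_col_affine (z : 'cV[R]_n) (B : 'M[R]_n) A : B \in unitmx ->
  borel A ->
  lebesgue_col n [set z + B *m x | x in A] =
    (`|\det B|%:E * lebesgue_col n A)%E.
Proof.
move=> uB bA; have mA := (borelP A).1 bA.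
rewrite !lebesgue_col_borel//; last exact: borel_affine_image.
by rewrite affine_image_preimage// tuple_lebesgue_affine ?unitmx_inv// det_inv normrV
  ?invrK// -unitmxE.
Qed.

(** The sigma-algebra is generated by the coordinates, so an open set is exhibited as a countable
    union of boxes with rational centres and radii [1 / (k + 1)]. *)
Lemma open_borel A : open A -> borel A.
Proof.
move=> oA; apply/borelP.
pose box (u : 'cV[rat]_n * nat) : set 'cV[R]_n :=
  [set x | forall i, `|x i ord0 - ratr (u.1 i ord0)| < u.2.+1%:R^-1].
have bbox u : measurable (@tuple_col R n @^-1` box u).
  rewrite (_ : _ @^-1` _ = \bigcap_(i in [set: 'I_n])
      ((@tnth n T)^~ i @^-1` ball (ratr (u.1 i ord0) : R) u.2.+1%:R^-1)).
    apply: fin_bigcap_measurable => // i _.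
    rewrite -[X in measurable X]setTI.
    by apply: (@measurable_tnth _ T) => //; exact: measurable_ball.
  apply/seteqP; split => t At i; first by move=> _; have := At i; rewrite mxE /= distrC.
  by have := At i I; rewrite /= /ball /= mxE distrC.
(* Boxes not contained in [A] are replaced by the empty set, so that the union runs over a whole
   countable type. *)
rewrite (_ : A = \bigcup_u (if `[< box u `<=` A >] then box u else set0));
  last first.
  apply/seteqP; split => [x Ax|x [u _]]; last by case: asboolP => // uA; exact: uA.
  have /nbhs_ballP[e /= e0 xeA] := open_nbhs_nbhs (conj oA Ax).
  (* The radius is below [e / 2] because points of the box are compared with [x] through the
     rational centre. *)
  have [k _ /(_ _ (leqnn k)) ke] :=
    near_infty_natSinv_lt (PosNum (divr_gt0 e0 (ltr0Sn R 1))).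
  have /choice[q qP] : forall i, exists p : rat, `|x i ord0 - ratr p| < k.+1%:R^-1.
    move=> i.
    have [|p] := @rat_in_itvoo R (x i ord0 - k.+1%:R^-1) (x i ord0 + k.+1%:R^-1).
      by rewrite ltrD2l gtrN// invr_gt0.
    by rewrite in_itv/= => ?; exists p; rewrite distrC ltr_distl.
  have xu : box (\col_i q i, k) x by move=> i /=; rewrite mxE.
  exists (\col_i q i, k) => //; case: asboolP => // -[] y yu; apply: xeA.
  split=> // i j; rewrite ord1 /ball /=.
  have := yu i; rewrite /= mxE => yi; have xi := qP i.
  rewrite (le_lt_trans (ler_distD (ratr (q i)) _ _))//.
  rewrite (splitr e) ltrD// ?(lt_trans xi)// distrC (lt_trans yi)//.
rewrite preimage_bigcup; apply: countable_bigcupT_measurable => [|u].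
  exact: countableP.
by case: asboolP => // _; rewrite preimage_set0.
Qed.

Lemma ler_entry_mx_norm (x : 'cV[R]_n) i : `|x i ord0| <= `|x|.
Proof.
have -> : `|x| = mx_norm x by [].
rewrite mx_normrE.
by apply: (@le_bigmax _ _ _ _ (fun ij => `|x ij.1 ij.2|) (i, ord0)).
Qed.

Lemma lebesgue_col_bounded A : borel A -> bounded_set A ->
  (lebesgue_col n A < +oo)%E.
Proof.
move=> bA [M [_ AM]].
(* Boundedness gives the bound [|M| + 1], which exceeds [M]; one more unit makes the lower
   inequality of the half-open box strict. *)
pose a : 'cV[R]_n := const_mx (- (`|M| + 2)).
pose b : 'cV[R]_n := const_mx (`|M| + 2).
have Mp : 0 <= `|M| + 2 by rewrite addr_ge0.
have ab i : a i ord0 <= b i ord0 by rewrite !mxE ge0_cp.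
rewrite (@le_lt_trans _ _ (\prod_i (b i ord0 - a i ord0))%:E) ?ltry//.
rewrite -lebesgue_col_box// lebesgue_col_borel//.
have [mB _] := @tuple_lebesgue_box R n (a^~ ord0) (b^~ ord0) ab.
have BE : @tuple_col R n @^-1`
    [set x | forall i, a i ord0 < x i ord0 <= b i ord0] =
    [set t | forall i, a i ord0 < tnth t i <= b i ord0].
  by apply/seteqP; split => t H i; have := H i; rewrite [tuple_col _ _ _]mxE.
rewrite lebesgue_col_borel; last by apply/borelP; rewrite BE.
rewrite le_measure ?inE//; [exact/borelP|by rewrite BE|] => t At i.
have := le_trans (ler_entry_mx_norm (tuple_col t) i) (AM (`|M| + 1) _ _ At).
rewrite !mxE => /(_ _)/wrap[].
  by rewrite (le_lt_trans (ler_norm _))// ltrDl.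
rewrite ler_norml => /andP[h1 h2]; apply/andP; split; lra.
Qed.

Lemma lebesgue_col_open_gt0 A : open A -> A !=set0 -> (0 < lebesgue_col n A)%E.
Proof.
move=> oA [x Ax].
have /nbhs_ballP[e /= e0 xeA] := open_nbhs_nbhs (conj oA Ax).
(* A box of side [e / 2] with upper corner [x] lies in the sup-norm ball of radius [e] and has
   positive volume. *)
pose a : 'cV[R]_n := x - const_mx (e / 2); pose b : 'cV[R]_n := x.
have ab i : a i ord0 <= b i ord0 by rewrite !mxE; lra.
have [mB _] := @tuple_lebesgue_box R n (a^~ ord0) (b^~ ord0) ab.
have BE : @tuple_col R n @^-1`
    [set x | forall i, a i ord0 < x i ord0 <= b i ord0] =
    [set t | forall i, a i ord0 < tnth t i <= b i ord0].
  by apply/seteqP; split => t H i; have := H i; rewrite [tuple_col _ _ _]mxE.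
rewrite (@lt_le_trans _ _ (\prod_i (b i ord0 - a i ord0))%:E)//.
  rewrite lte_fin prodr_gt0// => i _; rewrite !mxE; lra.
have bA := open_borel oA.
rewrite -lebesgue_col_box// !lebesgue_col_borel//; last by apply/borelP; rewrite BE.
rewrite le_measure ?inE//; [by rewrite BE|exact/borelP|] => t At; apply: xeA.
split=> // i j; rewrite ord1; have := At i; rewrite !mxE /ball /=.
by rewrite ltr_norml => /andP[h1 h2]; apply/andP; split; lra.
Qed.

End lebesgue_col_affine.

(** * Euclidean norm, operator norm and diameter *)

Section euclidean_norm.
Context {R : realType}.

Lemma enorm_ge0 n (x : 'cV[R]_n) : 0 <= enorm x.
Proof. exact: sqrtr_ge0. Qed.

Lemma ler_entry_enorm n (x : 'cV[R]_n) i : `|x i ord0| <= enorm x.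
Proof.
rewrite -sqrtr_sqr ler_wsqrtr// (bigD1 i)//= lerDl.
by apply: sumr_ge0 => j _; exact: sqr_ge0.
Qed.

Lemma enorm_eq0 n (x : 'cV[R]_n) : enorm x = 0 -> x = 0.
Proof.
move=> x0; apply/colP => i; rewrite mxE; apply/eqP; rewrite -normr_le0 -x0.
exact: ler_entry_enorm.
Qed.

Lemma enormZ n (a : R) (x : 'cV[R]_n) : enorm (a *: x) = `|a| * enorm x.
Proof.
rewrite /enorm -sqrtr_sqr -sqrtrM ?sqr_ge0// mulr_sumr; congr Num.sqrt.
by apply: eq_bigr => i _; rewrite mxE exprMn.
Qed.

(** Supplies the upper bounds that make the suprema in [opnorm] and [diam] genuine. *)
Lemma enorm_ubound n (x : 'cV[R]_n) c : (forall i, `|x i ord0| <= c) ->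
  enorm x <= Num.sqrt (n%:R * c ^+ 2).
Proof.
move=> xc; rewrite ler_wsqrtr// mulr_natl -[X in _ *+ X](card_ord n) -sumr_const.
apply: ler_sum => i _; rewrite -[leLHS]real_normK ?num_real// lerXn2r// nnegrE//.
exact: le_trans (xc i).
Qed.

Lemma enorm_mulmx_le n (B : 'M[R]_n) (x : 'cV[R]_n) :
  enorm (B *m x) <= opnorm B * enorm x.
Proof.
have [/eqP/enorm_eq0 ->|x0] := boolP (enorm x == 0).
  by rewrite mulmx0 -(scale0r (0 : 'cV[R]_n)) enormZ normr0 !mul0r mulr0.
have xgt0 : 0 < enorm x by rewrite lt_neqAle eq_sym x0 enorm_ge0.
(* By homogeneity, [x] is replaced by the unit vector in its direction. *)
rewrite -ler_pdivrMr// mulrC -[X in X * _]gtr0_norm ?invr_gt0// -enormZ scalemxAr.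
apply: ub_le_sup.
  (* On the unit ball each entry of [B *m y] is at most the sum of all [|B i j|]. *)
  exists (Num.sqrt (n%:R * (\sum_i \sum_j `|B i j|) ^+ 2)) => _ [y /= y1 <-].
  apply: enorm_ubound => i; rewrite mxE (le_trans (ler_norm_sum _ _ _))//.
  rewrite [leRHS](bigD1 i)//= -[leLHS]addr0 lerD//; last first.
    by apply: sumr_ge0 => k _; apply: sumr_ge0.
  apply: ler_sum => j _; rewrite normrM ler_piMr//.
  exact: le_trans (ler_entry_enorm _ _) y1.
exists ((enorm x)^-1 *: x) => //=.
by rewrite enormZ gtr0_norm ?invr_gt0// mulVf.
Qed.

Lemma opnorm_ge0 n (B : 'M[R]_n) : 0 <= opnorm B.
Proof.
rewrite /opnorm; set E := (X in sup X).
(* A set without a supremum gets the default value 0 from [sup]. *)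
have [[[e [x x1 xe]] ub]|E0] := pselect (has_sup E);
  last by rewrite (sup_out E0).
rewrite (le_trans (enorm_ge0 (B *m x)))//.
by apply: (ub_le_sup ub); exists x.
Qed.

Lemma enorm_le_diam n (D : set 'cV[R]_n) x y : bounded_set D -> D x -> D y ->
  enorm (x - y) <= diam D.
Proof.
move=> [M [_ DM]] Dx Dy; apply: ub_le_sup; last by exists x => //; exists y.
(* All entries of points of [D] are bounded by [|M| + 1], hence those of a difference by twice
   that. *)
exists (Num.sqrt (n%:R * (2 * (`|M| + 1)) ^+ 2)) => _ [u Du [w Dw <-]].
apply: enorm_ubound => i; rewrite mxE [X in _ + X]mxE.
have M1 : M < `|M| + 1 by rewrite (le_lt_trans (ler_norm _))// ltrDl.
rewrite (le_trans (ler_normB _ _))// mulr_natl mulr2n.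
by rewrite lerD// (le_trans (ler_entry_mx_norm _ _))//; exact: DM M1 _ _.
Qed.

Lemma enorm_affine_le n (D : set 'cV[R]_n) (z : 'cV[R]_n) (B : 'M[R]_n) x y :
  bounded_set D -> [set z + B *m u | u in D] x -> [set z + B *m u | u in D] y ->
  enorm (x - y) <= opnorm B * diam D.
Proof.
move=> bD [u Du <-] [w Dw <-]; rewrite opprD addrACA subrr add0r -mulmxBr.
by rewrite (le_trans (enorm_mulmx_le _ _))// ler_wpM2l ?opnorm_ge0// enorm_le_diam.
Qed.

End euclidean_norm.

(** * Comparison of integrals of nonnegative functions *)

Section nonneg_integral_comparison.
Context d {T : measurableType d} {R : realType}.
Variable mu : {measure set T -> \bar R}.
Local Open Scope ereal_scope.

(* The dominating function is not assumed to be measurable: the integral of a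
   nonnegative function is a supremum over the simple functions below it. *)
Lemma ge0_le_integral_nonmeasurable (D : set T) (f g : T -> \bar R) :
  (forall x, D x -> 0 <= f x) -> (forall x, D x -> f x <= g x) ->
  \int[mu]_(x in D) f x <= \int[mu]_(x in D) g x.
Proof.
move=> f0 fg; have g0 x : D x -> 0 <= g x.
  by move=> Dx; exact: le_trans (f0 _ Dx) (fg _ Dx).
rewrite !ge0_integralE//; apply: le_ereal_sup => _ [h /= hf <-]; exists h => //= x.
apply: le_trans (hf x) _; rewrite /patch; case: ifPn => // /set_mem; exact: fg.
Qed.

(** For positive [K] the constant is moved to the side of the measurable [f], which leaves the
    comparison of [K^-1 * f] with [g]. *)
Lemma ge0_le_integral_scale (D : set T) (K : R) (f g : T -> \bar R) :
  measurable D -> (0 <= K)%R -> measurable_fun D f ->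
  (forall x, D x -> 0 <= f x) -> (forall x, D x -> 0 <= g x) ->
  (forall x, D x -> f x <= K%:E * g x) ->
  \int[mu]_(x in D) f x <= K%:E * \int[mu]_(x in D) g x.
Proof.
move=> mD; rewrite le_eqVlt => /predU1P[<- mf f0 g0 fg|K0 mf f0 g0 fg].
  (* For [K = 0] the bound forces [f] to vanish, even where [g] is infinite, since [0 * +oo = 0]. *)
  rewrite mul0e integral0_eq// => x Dx; apply/eqP; rewrite eq_le f0// andbT.
  by rewrite (le_trans (fg _ Dx))// mul0e.
rewrite -[leLHS]mul1e -(divff (lt0r_neq0 K0)) EFinM -muleA.
rewrite lee_pmul2l// -ge0_integralZl//; last by rewrite lee_fin invr_ge0 ltW.
apply: ge0_le_integral_nonmeasurable => x Dx.
  by rewrite mule_ge0 ?f0// lee_fin invr_ge0 ltW.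
by rewrite muleC lee_pdivrMr// muleC fg.
Qed.

End nonneg_integral_comparison.

(** * The variance identity and an abstract Poincare inequality *)

Section variance.
Context d {T : measurableType d} {R : realType}.
Variables (mu : {measure set T -> \bar R}) (D : set T) (v : T -> R).
Hypotheses (mD : measurable D) (finD : (mu D < +oo)%E).
Hypothesis mv : measurable_fun D v.
Hypothesis v2 : (\int[mu]_(x in D) (v x ^+ 2)%:E < +oo)%E.

Definition mean : R := fine (\int[mu]_(x in D) (v x)%:E) / fine (mu D).

Let integrable_sqr : mu.-integrable D (fun x => (v x ^+ 2)%:E).
Proof.
apply/integrableP; split.
  by apply/measurable_EFinP; exact: measurable_funX.
under eq_integral do rewrite /= ger0_norm ?sqr_ge0//.
exact: v2.
Qed.

Let integrable_cst c : mu.-integrable D (fun=> c%:E).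
Proof.
apply/integrableP; split; first exact/measurable_EFinP.
by rewrite integral_cst// lte_mul_pinfty.
Qed.

Let integrable_id : mu.-integrable D (fun x => (v x)%:E).
Proof.
(* On a set of finite measure [1 + v ^+ 2] is integrable, and it dominates [|v|]. *)
apply: (le_integrable mD _ _ (integrableD mD (integrable_cst 1) integrable_sqr)).
  exact/measurable_EFinP.
move=> x Dx /=; rewrite lee_fin [leRHS]ger0_norm ?addr_ge0 ?sqr_ge0//.
by rewrite ler_norml; apply/andP; split; nra.
Qed.

Lemma integral_quadratic a b c :
  (\int[mu]_(x in D) (a * v x ^+ 2 + b * v x + c)%:E =
   (a * fine (\int[mu]_(x in D) (v x ^+ 2)%:E) +
    b * fine (\int[mu]_(x in D) (v x)%:E) + c * fine (mu D))%:E)%E.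
Proof.
have i2 := integrableZl mD a integrable_sqr.
have i1 := integrableZl mD b integrable_id.
have i0 := integrable_cst c.
under eq_integral do rewrite !EFinD !EFinM.
rewrite integralD//; last exact: integrableD.
rewrite integralD// !integralZl// integral_cst//.
rewrite !EFinD !EFinM !fineK//; [|exact: integrable_fin_num..].
by rewrite ge0_fin_numE.
Qed.

(** With [I1] and [I2] the integrals of [v] and [v ^+ 2], both sides equal
    [2 * (mu D * I2 - I1 ^+ 2)]. *)
Lemma integral_sqr_sub_mean : (0 < mu D)%E ->
  ((2 * fine (mu D))%:E * \int[mu]_(x in D) ((v x - mean) ^+ 2)%:E =
   \int[mu]_(y in D) \int[mu]_(x in D) ((v x - v y) ^+ 2)%:E)%E.
Proof.
move=> D0; have V0 : fine (mu D) != 0 by rewrite gt_eqF// fine_gt0// D0.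
have sqrB (c : R) x : (v x - c) ^+ 2 = 1 * v x ^+ 2 + (- 2 * c) * v x + c ^+ 2 by ring.
under eq_integral do rewrite sqrB.
under [in RHS]eq_integral => y _.
  under eq_integral do rewrite sqrB.
  rewrite integral_quadratic.
  (* The inner integral is arranged as a quadratic polynomial in [v y], ready for a second use of
     [integral_quadratic]. *)
  rewrite (_ : (_ + _ * fine (mu D))%R = (fine (mu D) * v y ^+ 2 +
    (- 2 * fine (\int[mu]_(x in D) (v x)%:E)) * v y +
    fine (\int[mu]_(x in D) (v x ^+ 2)%:E))%R); last by ring.
  over.
rewrite !integral_quadratic -EFinM; congr (_%:E); rewrite /mean; field; exact: V0.
Qed.

Lemma integral_sqr_sub_mean_le (K : R) (k : T -> T -> R) : (0 < mu D)%E ->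
  0 <= K -> (forall x y, D x -> D y -> 0 <= k x y) ->
  (forall x y, D x -> D y -> (v x - v y) ^+ 2 <= K * k x y) ->
  (\int[mu]_(x in D) ((v x - mean) ^+ 2)%:E <=
   (K / (2 * fine (mu D)))%:E *
     \int[mu]_(y in D) \int[mu]_(x in D) (k x y)%:E)%E.
Proof.
move=> D0 K0 k0 vk; have V0 : 0 < fine (mu D) by rewrite fine_gt0// D0.
have mB (c : R) : measurable_fun D (fun x => ((v x - c) ^+ 2)%:E).
  by apply/measurable_EFinP/measurable_funX; exact: measurable_funB.
rewrite EFinM muleAC lee_pdivlMr ?mulr_gt0// muleC integral_sqr_sub_mean//.
apply: ge0_le_integral_scale => //.
(* Measurability of the inner integral in [y] is read off its closed form, a quadratic polynomial in
   [v y]. *)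
- have -> : (fun y => \int[mu]_(x in D) ((v x - v y) ^+ 2)%:E)%E = (fun y =>
      ((1 * fine (\int[mu]_(x in D) (v x ^+ 2)%:E) +
      (- 2 * v y) * fine (\int[mu]_(x in D) (v x)%:E) + v y ^+ 2 * fine (mu D))%:E)%E).
    apply/funext => y; rewrite -integral_quadratic; apply: eq_integral => x _.
    by congr (_%:E); ring.
  apply/measurable_EFinP; apply: measurable_funD; last first.
    by apply: measurable_funM => //; exact: measurable_funX.
  by apply: measurable_funD => //; do 2 apply: measurable_funM => //.
- by move=> y Dy; apply: integral_ge0 => x Dx; rewrite lee_fin sqr_ge0.
- by move=> y Dy; apply: integral_ge0 => x Dx; rewrite lee_fin k0.
- move=> y Dy; apply: ge0_le_integral_scale => //.
  + by move=> x Dx; rewrite lee_fin sqr_ge0.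
  + by move=> x Dx; rewrite lee_fin k0.
  + by move=> x Dx; rewrite -EFinM lee_fin vk.
Qed.

End variance.

(** * Sobolev-Slobodeckij and quotient semi-norms *)

Section sobolev_slobodeckij_seminorms.
Context {R : realType} {n : nat}.
Implicit Types (D : set 'cV[R]_n) (v : 'cV[R]_n -> R) (s : R).

Lemma sqr_poweR_half (x : \bar R) : (0 <= x)%E -> ((x `^ 2^-1) ^+ 2 = x)%E.
Proof. by move=> x0; rewrite poweR12_sqrt// sqr_sqrte. Qed.

Lemma slobodeckij_ge0 s D v : (0 <= slobodeckij s D v)%E.
Proof. exact: poweR_ge0. Qed.

Lemma sqr_slobodeckij s D v : (slobodeckij s D v ^+ 2 =
  \int[lebesgue_col n]_(y in D) \int[lebesgue_col n]_(x in D)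
     (`|v x - v y| ^+ 2 / enorm (x - y) `^ (n%:R + 2 * s))%:E)%E.
Proof.
rewrite sqr_poweR_half//; do 2 (apply: integral_ge0 => ? _).
by rewrite lee_fin divr_ge0 ?sqr_ge0 ?powR_ge0.
Qed.

Lemma sqr_L2norm D v :
  (L2norm D v ^+ 2 = \int[lebesgue_col n]_(x in D) (v x ^+ 2)%:E)%E.
Proof.
by rewrite sqr_poweR_half//; apply: integral_ge0 => x _; rewrite lee_fin sqr_ge0.
Qed.

Lemma sqr_sobolev_norm s D v :
  (sobolev_norm s D v ^+ 2 = L2norm D v ^+ 2 + slobodeckij s D v ^+ 2)%E.
Proof. by rewrite sqr_poweR_half// adde_ge0// expe_ge0// poweR_ge0. Qed.

Lemma slobodeckij_add_cst s D v c :
  slobodeckij s D (fun x => v x + c) = slobodeckij s D v.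
Proof.
rewrite /slobodeckij; congr (_ `^ _)%E; apply: eq_integral => y _.
by apply: eq_integral => x _; rewrite opprD addrACA subrr addr0.
Qed.

Lemma slobodeckij_le_sobolev_norm s D v :
  (slobodeckij s D v <= sobolev_norm s D v)%E.
Proof.
by rewrite -lee_sqr ?poweR_ge0// sqr_sobolev_norm leeDr// expe_ge0// poweR_ge0.
Qed.

Lemma quotient_seminorm_ge0 s D v : (0 <= quotient_seminorm s D v)%E.
Proof. by apply: le_ereal_inf_tmp => _ [c _ <-]; exact: poweR_ge0. Qed.

Lemma slobodeckij_le_quotient_seminorm s D v :
  (slobodeckij s D v <= quotient_seminorm s D v)%E.
Proof.
apply: le_ereal_inf_tmp => _ [c _ <-].
by rewrite -(slobodeckij_add_cst s D v c); exact: slobodeckij_le_sobolev_norm.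
Qed.

(** Subtracting the mean leaves the Slobodeckij part unchanged and gives the summand 1; the
    remaining L2 part is bounded by [integral_sqr_sub_mean_le] with the Slobodeckij quotient as
    kernel. *)
Lemma sqr_quotient_seminorm_le s D v (K : R) :
  measurable (D : set (lebesgue_space R n)) ->
  (0 < lebesgue_col n D < +oo)%E -> 0 < s -> sobolev s D v -> 0 <= K ->
  (forall x y, D x -> D y -> enorm (x - y) <= K) ->
  (quotient_seminorm s D v ^+ 2 <=
    (1 + K `^ (n%:R + 2 * s) / (2 * volume D))%:E * slobodeckij s D v ^+ 2)%E.
Proof.
move=> mD /andP[D0 Doo] s0 [mv vL2 _] K0 DK.
set p := n%:R + 2 * s; have p0 : 0 < p by rewrite ltr_wpDl// mulr_gt0.
have v2 : (\int[lebesgue_col n]_(x in D) (v x ^+ 2)%:E < +oo)%E.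
  by rewrite -sqr_L2norm expe2 lte_mul_pinfty ?poweR_ge0// ge0_fin_numE// poweR_ge0.
pose m := mean (lebesgue_col n) D v.
have qN : (quotient_seminorm s D v <=
    sobolev_norm s D (fun x => (v x + - m)%R))%E.
  by apply: ereal_inf_lbound; exists (- m).
rewrite (@le_trans _ _ (sobolev_norm s D (fun x => (v x + - m)%R) ^+ 2)%E)//.
  by rewrite lee_sqr ?quotient_seminorm_ge0 ?poweR_ge0.
rewrite sqr_sobolev_norm slobodeckij_add_cst EFinD ge0_muleDl//; last first.
  by rewrite lee_fin divr_ge0 ?powR_ge0// mulr_ge0// fine_ge0.
rewrite mul1e addeC leeD2l// sqr_L2norm sqr_slobodeckij.
apply: (integral_sqr_sub_mean_le mD Doo mv v2 D0) => [|x y _ _|x y Dx Dy].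
- exact: powR_ge0.
- by rewrite divr_ge0 ?sqr_ge0 ?powR_ge0.
(* On the diagonal both sides are 0; off it the quotient has a positive denominator, at most [K] to
   the power [p]. *)
have [->|xy] := eqVneq x y; first by rewrite subrr normr0 !expr0n mul0r mulr0.
have xy0 : 0 < enorm (x - y).
  rewrite lt_neqAle enorm_ge0 andbT eq_sym; apply: contraNneq xy => /enorm_eq0/eqP.
  by rewrite subr_eq0.
rewrite real_normK ?num_real// mulrCA ler_peMr ?sqr_ge0//.
rewrite ler_pdivlMr ?powR_gt0// mul1r ge0_ler_powR ?nnegrE ?enorm_ge0 ?(ltW p0)//.
exact: DK.
Qed.

(** The left side is the square obtained by keeping the second argument of the maximum. *)
Lemma sqr_CPFSS_ge s D : 0 < volume D -> 0 <= diam D ->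
  diam D `^ (n%:R + 2 * s) / (2 * volume D) <= CPFSS s D ^+ 2.
Proof.
move=> V0 d0; rewrite /CPFSS exprMn.
have sqr_powR (a b : R) : (a `^ b) ^+ 2 = a `^ (b * 2).
  by rewrite powRrM powR_mulrn ?powR_ge0.
rewrite sqr_powR.
rewrite (_ : - 2^-1 * 2 = -1) ?mulNr ?mulVf// powR_inv1 ?(ltW V0)//.
rewrite invfM mulrA mulrC ler_wpM2l ?invr_ge0 ?(ltW V0)//.
set M := 2 `^ (- 2^-1) * _.
rewrite (@le_trans _ _ (M ^+ 2))//; last first.
  by rewrite lerXn2r ?nnegrE ?mulr_ge0 ?powR_ge0 ?le_max ?ler01 ?lexx ?orbT.
rewrite /M exprMn !sqr_powR.
rewrite mulNr mulVf// powR_inv1// mulrC (_ : _ * 2%:R = n%:R + 2 * s)//.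
by field.
Qed.

Lemma diam_ge0 D : 0 <= diam D.
Proof.
rewrite /diam; set E := (X in sup X).
have [[[e0 [x Dx [y Dy xy]]] ub]|E0] := pselect (has_sup E);
  last by rewrite (sup_out E0).
rewrite (le_trans (enorm_ge0 (x - y)))//.
by apply: (ub_le_sup ub); exists x => //; exists y.
Qed.

End sobolev_slobodeckij_seminorms.

(** * The two estimates on the affine image *)

Theorem theorem3p2 (R : realType) (n : nat) (Dhat : set 'cV[R]_n)
    (x0 : 'cV[R]_n) (B : 'M[R]_n) (hDhat : lipschitz_domain Dhat)
    (hB : B \in unitmx) (D : set 'cV[R]_n)
    (hD : D = [set x0 + B *m xhat | xhat in Dhat])
    (s : R) (hs : 0 < s < 1) (v : 'cV[R]_n -> R) (hv : sobolev s D v) :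
  (slobodeckij s D v <= quotient_seminorm s D v)%E /\
  (quotient_seminorm s D v ^+ 2 <=
    (1 + `|\det B|^-1 * opnorm B `^ (n%:R + 2 * s) * CPFSS s Dhat ^+ 2)%:E *
    slobodeckij s D v ^+ 2)%E.
Proof.
split; first exact: slobodeckij_le_quotient_seminorm.
case: hDhat => Dhat0 oDhat bDhat _ _; case/andP: hs => s0 _.
have borDhat := open_borel oDhat.
have finDhat := lebesgue_col_bounded borDhat bDhat.
have Dhat_gt0 := lebesgue_col_open_gt0 oDhat Dhat0.
have detB0 : 0 < `|\det B| by rewrite normr_gt0 -unitfE -unitmxE.
have DE : lebesgue_col n D = (`|\det B|%:E * lebesgue_col n Dhat)%E.
  by rewrite hD lebesgue_col_affine.
have VhatE : 0 < volume Dhat by rewrite fine_gt0// Dhat_gt0.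
have VE : volume D = `|\det B| * volume Dhat.
  by rewrite /volume DE fineM// ge0_fin_numE// ltW.
have d0 := diam_ge0 Dhat; have B0 := opnorm_ge0 B.
have mD : measurable (D : set (lebesgue_space R n)).
  by apply: borel_lebesgue_measurable; rewrite hD; exact: borel_affine_image.
(* [K] bounds all distances between points of [D]. *)
pose K := opnorm B * diam Dhat.
apply: le_trans (@sqr_quotient_seminorm_le _ _ s D v K mD _ s0 hv _ _) _.
- by rewrite DE mule_gt0 ?lte_fin// lte_mul_pinfty ?lee_fin.
- exact: mulr_ge0.
- by move=> x y; rewrite hD; exact: enorm_affine_le.
rewrite lee_wpmul2r ?expe_ge0 ?slobodeckij_ge0// lee_fin lerD2l VE powRM//.
(* The factors depending on [B] are separated from a term in [Dhat] alone, which [sqr_CPFSS_ge]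
   bounds. *)
rewrite (_ : _ / _ = `|\det B|^-1 * opnorm B `^ (n%:R + 2 * s) *
    (diam Dhat `^ (n%:R + 2 * s) / (2 * volume Dhat))); last first.
  by field; rewrite !gt_eqF.
by rewrite ler_wpM2l ?sqr_CPFSS_ge// mulr_ge0 ?powR_ge0// invr_ge0.
Qed.
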